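(* Let $P$ be a nonempty set, $X$ and $Y$ metric spaces, $F:P\times X\rightrightarrows Y$ a set-valued mapping, $\bar x\in X$, $\bar y\in Y$, $\alpha>0$, $\delta\in]0,+\infty]$ and $\mu\in]0,+\infty]$. For $\gamma>0$, $p\in P$ and $(x,y)\in\operatorname{gph}F_p$ consider the inequality $$(\ast)\qquad \sup_{\substack{(u,v)\in\operatorname{gph} F_p,\ (u,v)\ne (x,y)\\ d(u,\bar x)<\delta+\mu,\ d(v,\bar y)<\alpha\mu}} \frac{d(y,\bar y)-d(v,\bar y)}{d_\gamma((u,v),(x,y))}\ge\alpha .$$ (i) If $F$ is $\alpha$-subregular in $x$ uniformly in $p$ over $P$ at $(\bar x,\bar y)$ with $\delta$ and $\mu$, then $(\ast)$ holds with $\gamma:=\alpha^{-1}$ for all $p\in P$, $x\in B_\delta(\bar x)$ and $y\in Y$ satisfying $x\notin F_p^{-1}(\bar y)$ and $y\in F(p,x)\cap B_{\alpha\mu}(\bar y)$. (ii) Suppose $X$ and $Y$ are complete, and $\operatorname{gph}F_p$ is closed for all $p\in P$. If there is a $\gamma>0$ such that $(\ast)$ holds for all $p\in P$, $x\in B_{\delta+\mu}(\bar x)$ and $y\in Y$ satisfying $x\notin F_p^{-1}(\bar y)$ and $y\in F(p,x)\cap B_{\alpha\mu}(\bar y)$, then $F$ is $\alpha$-subregular in $x$ uniformly in $p$ over $P$ at $(\bar x,\bar y)$ with $\delta$ and $\mu$.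
   Context: $B_r(z)$ denotes the open ball with center $z$ and radius $r\in]0,+\infty]$ (the whole space if $r=+\infty$). $d(z,\Omega):=\inf_{w\in\Omega}d(z,w)$, with $d(z,\emptyset)=+\infty$. For $p\in P$, $F_p:=F(p,\cdot):X\rightrightarrows Y$, $\operatorname{gph}F_p=\{(x,y)\in X\times Y\mid y\in F(p,x)\}$, $F_p^{-1}(y)=\{x\in X\mid y\in F(p,x)\}$. Values of set-valued mappings may be empty. For $\gamma>0$, $d_\gamma((u,v),(x,y)):=\max\{d(u,x),\gamma\, d(v,y)\}$ on $X\times Y$. Definition. $F$ is $\alpha$-subregular in $x$ uniformly in $p$ over $P$ at $(\bar x,\bar y)$ with $\delta$ and $\mu$ if $\alpha\, d(x,F_p^{-1}(\bar y))\le d(\bar y,F(p,x))$ for all $p\in P$ and $x\in B_\delta(\bar x)$ with $d(\bar y,F(p,x))<\alpha\mu$. A supremum over the empty set is understood as $-\infty$. *)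

(* Defs.v *)
From mathcomp Require Import all_boot all_order all_algebra.
From mathcomp Require Import all_classical all_reals all_analysis.

Set Implicit Arguments.
Unset Strict Implicit.
Unset Printing Implicit Defensive.

Import Order.TTheory GRing.Theory Num.Theory.

Local Open Scope classical_set_scope.
Local Open Scope ring_scope.

Section MetricNotions.
Context {R : realType} {X : metricType R}.

(* The library's [ball] only takes radii in [R]; here the radius may be [+oo],
   in which case the ball is the whole space. *)
Definition eball (z : X) (r : \bar R) : set X :=
  [set w | ((mdist w z)%:E < r)%E].

(* Takes the value [+oo] when [A] is empty. *)
Definition dist_set (z : X) (A : set X) : \bar R :=
  ereal_inf [set (mdist z w)%:E | w in A].

(* The library's [completeType] requires a distinguished point, which a
   [metricType] does not carry. *)
Definition complete_metric : Prop :=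
  forall u : nat -> X, cauchy (u @ \oo) -> exists l : X, u @ \oo --> l.

End MetricNotions.
Arguments complete_metric {R} X.

Section SetValued.
Context {R : realType} {P : Type} {X Y : metricType R}.

Definition gph (G : X -> set Y) : set (X * Y) := [set xy | G xy.1 xy.2].

Definition inv_val (G : X -> set Y) (y : Y) : set X := [set x | G x y].

Definition dgamma (gamma : R) (uv xy : X * Y) : R :=
  Num.max (mdist uv.1 xy.1) (gamma * mdist uv.2 xy.2).

Definition subregular_unif (F : P -> X -> set Y) (xbar : X) (ybar : Y)
    (alpha : R) (delta mu : \bar R) : Prop :=
  forall (p : P) (x : X), eball xbar delta x ->
    (dist_set ybar (F p x) < alpha%:E * mu)%E ->
    (alpha%:E * dist_set x (inv_val (F p) ybar) <= dist_set ybar (F p x))%E.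

(* The supremum is taken in [\bar R]; it is [-oo] over the empty set. *)
Definition slope_sup (G : X -> set Y) (xbar : X) (ybar : Y)
    (alpha : R) (delta mu : \bar R) (gamma : R) (xy : X * Y) : \bar R :=
  ereal_sup
    [set ((mdist xy.2 ybar - mdist uv.2 ybar) / dgamma gamma uv xy)%:E
    | uv in [set uv | [/\ gph G uv, uv <> xy,
                          ((mdist uv.1 xbar)%:E < delta + mu)%E &
                          ((mdist uv.2 ybar)%:E < alpha%:E * mu)%E]]].

End SetValued.

(* Main.v *)
(** For (i), near-minimisers [u] of the distance from [x] to the solution set
    give points [(u, ybar)] of the graph whose slope against [(x, y)] is
    arbitrarily close to [alpha] or larger.

    For (ii), suppose subregularity fails at [x]. Some [y] in [F p x] then has
    [d(y, ybar) < alpha * r], where [r] is the smaller of [mu] and the distance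
    from [x] to the solution set, and this survives replacing [alpha] by a
    slightly smaller [a]. Ekeland's principle for [(u, v) |-> d(v, ybar)] on the
    closed graph, with slope [a] in the metric [dgamma], yields a point closer
    than [r] to [(x, y)], hence not a solution, at which no slope exceeds
    [a]; this contradicts the lower bound [alpha] on the supremum. *)

Require Import Defs.
From mathcomp Require Import all_boot all_order all_algebra.
From mathcomp Require Import all_classical all_reals all_analysis.
From mathcomp Require Import lra.

Set Implicit Arguments.
Unset Strict Implicit.
Unset Printing Implicit Defensive.

Import Order.TTheory GRing.Theory Num.Theory.
Import numFieldNormedType.Exports.

Local Open Scope classical_set_scope.
Local Open Scope ring_scope.

(* The order-theoretic core of Ekeland's principle: at each step move to a point
   at least halfway down to the infimum of [f] below the current one. *)
Lemma brezis_browder (R : realType) (T : Type) (below : T -> T -> Prop)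
    (f : T -> R)
    (below_refl : forall z, below z z)
    (below_trans : forall y x z, below x y -> below y z -> below x z)
    (f_mono : forall w z, below w z -> f w <= f z)
    (f_ge0 : forall z, 0 <= f z)
    (chain : forall u : nat -> T, (forall n, below (u n.+1) (u n)) ->
       exists z, forall n, below z (u n)) (x : T) :
  exists2 z, below z x & forall w, below w z -> f w = f z.
Proof.
have step z : {y | below y z /\ forall w, below w z -> f y + f y <= f z + f w}.
  apply: cid; set S := [set f w | w in [set w | below w z]].
  have lbS : lbound S 0 by move=> _ [w _ <-].
  have infS : has_inf S by split; [exists (f z), z | exists 0].
  have leS w : below w z -> inf S <= f w.
    by move=> wz; apply: ge_inf; [exists 0 | exists w].
  (* If [z] already attains the infimum there is no gap to halve, and [z] itself serves as the next
     point. *)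
  have [fz|zS] := leP (f z) (inf S).
    by exists z; split=> // w /leS; lra.
  have e0 : 0 < (f z - inf S) / 2 by lra.
  have [_ [y yz <-] ylt] := inf_adherent e0 infS.
  by exists y; split=> // w /leS; lra.
have [u [u0 uS]] := dependent_choice step x.
have [z zu] : exists z, forall n, below z (u n).
  by apply: chain => n; case: (uS n).
have uni : nonincreasing_seq (f \o u).
  by apply/nonincreasing_seqP => n; apply: f_mono; case: (uS n).
have fcv : (f \o u) @ \oo --> limn (f \o u).
  by apply: nonincreasing_is_cvgn => //; exists 0 => _ [n _ <-]; apply: f_ge0.
exists z => [|w wz]; first by rewrite -u0.
apply/eqP; rewrite eq_le f_mono//=.
suff lw : limn (f \o u) <= f w.
  apply: (le_trans _ lw).
  by apply: limr_ge; [exact: fcv | apply: nearW => n; apply: f_mono].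
(* As [w] lies below every [u n], the halving inequality reads [2 f (u n.+1) <= f (u n) + f w]; the
   claim is its limit. *)
have : limn (f \o u) + limn (f \o u) <= limn (f \o u) + f w; last by lra.
have fcvS : (f \o u) n.+1 @[n --> \oo] --> limn (f \o u) by rewrite cvg_shiftS.
apply: (ler_cvg_to (cvgD fcvS fcvS) (cvgD fcv (cvg_cst _))).
apply: nearW => n /=; have [_] := uS n; apply.
exact: below_trans wz (zu n).
Qed.

Section MetricSequences.
Context {R : realType} {X : metricType R}.

Lemma cvg_mdist (T : Type) (D : set_system T) {FD : Filter D} (u : T -> X)
    (l y : X) :
  u @ D --> l -> mdist (u t) y @[t --> D] --> mdist l y.
Proof.
move=> /metricType_numDomainType.cvgrPdist_lt ul; apply/cvgrPdist_lt => e e0.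
apply: filterS (ul e e0) => n; apply: le_lt_trans.
have := metric_triangle l (u n) y; have := metric_triangle (u n) l y.
by rewrite (metric_sym (u n) l) ler_norml => *; apply/andP; split; lra.
Qed.

(** A convergent [g] has small differences, which control the distances in [u]. The factor [c]
    absorbs the weights [a] and [a * gamma] of the two coordinates in [ekeland]. *)
Lemma cauchy_dominated (u : nat -> X) (g : nat -> R) (L c : R) :
  0 < c -> g @ \oo --> L ->
  (forall n m, (n <= m)%N -> c * mdist (u m) (u n) <= g n - g m) ->
  cauchy (u @ \oo).
Proof.
move=> c0 gL ug; apply/cauchy_exP => e e0.
have ce0 : 0 < c * e / 2 by rewrite divr_gt0// mulr_gt0.
have [N _ gN] := (cvgrPdist_lt _ _).1 gL _ ce0.
exists (u N); exists N => // m /= Nm.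
rewrite ballEmdist/= metric_sym -(ltr_pM2l c0).
apply: le_lt_trans (ug _ _ Nm) _.
have := gN N (leqnn N); have := gN m Nm; rewrite /= !ltr_norml.
by move=> /andP[? ?] /andP[? ?]; lra.
Qed.

End MetricSequences.

Section ProductMetric.
Context {R : realType} {X Y : metricType R} (gamma : R) (gamma_gt0 : 0 < gamma).

Lemma dgammaxx (z : X * Y) : dgamma gamma z z = 0.
Proof. by rewrite /dgamma !mdistxx mulr0 maxxx. Qed.

Lemma dgamma_triangle (y w z : X * Y) :
  dgamma gamma w z <= dgamma gamma w y + dgamma gamma y z.
Proof.
rewrite ge_max; apply/andP; split.
  by apply: le_trans (metric_triangle _ y.1 _) _; rewrite lerD// le_max lexx.
apply: le_trans (_ : gamma * (mdist w.2 y.2 + mdist y.2 z.2) <= _).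
  by rewrite ler_pM2l// metric_triangle.
by rewrite mulrDr lerD// le_max lexx orbT.
Qed.

Lemma dgamma_gt0 (w z : X * Y) : w <> z -> 0 < dgamma gamma w z.
Proof.
case: w z => [w1 w2] [z1 z2] wz.
rewrite lt_max pmulr_rgt0// !mdist_gt0 -negb_and.
by apply/negP => /andP[/eqP/= e1 /eqP/= e2]; apply: wz; rewrite e1 e2.
Qed.

(** Apply [brezis_browder] to the order in which [w] is below [z] when the drop of [f] pays for [a]
    times the distance. Along a chain [f] converges, so both coordinates are Cauchy, and their limit
    bounds the chain. *)
Lemma ekeland (G : set (X * Y)) (f : X * Y -> R) (a : R) :
  complete_metric X -> complete_metric Y -> closed G -> continuous f ->
  (forall z, 0 <= f z) -> 0 < a -> forall x, G x ->
  exists z, [/\ G z, f z + a * dgamma gamma z x <= f x &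
    forall w, G w -> f w + a * dgamma gamma w z <= f z -> w = z].
Proof.
move=> cX cY clG cf f0 a0 x Gx.
(* Ordering the points of [G] only forces the bound of a chain to lie in [G], which is where
   closedness enters. *)
pose below (w z : {z | G z}) :=
  f (sval w) + a * dgamma gamma (sval w) (sval z) <= f (sval z).
have dge0 (w z : X * Y) : 0 <= a * dgamma gamma w z.
  by rewrite mulr_ge0 ?(ltW a0)// le_max mdist_ge0.
have below_refl z : below z z by rewrite /below dgammaxx mulr0 addr0.
have below_trans y w z : below w y -> below y z -> below w z.
  rewrite /below => wy yz; have := dgamma_triangle (sval y) (sval w) (sval z).
  by rewrite -(ler_pM2l a0) mulrDr; lra.
have mono w z : below w z -> f (sval w) <= f (sval z).
  by rewrite /below; have := dge0 (sval w) (sval z); lra.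
have [|||||z zx zmin] :=
  @brezis_browder R _ below (f \o sval) _ _ _ _ _ (exist _ x Gx) => //.
  by move=> z; exact: f0.
  move=> u us; pose v n := sval (u n); pose g := f \o v.
  have um n m : (n <= m)%N -> below (u m) (u n).
    elim: m => [|m IH]; first by rewrite leqn0 => /eqP ->.
    by rewrite leq_eqVlt => /predU1P[->//|/IH]; apply: below_trans.
  have uv n m : (n <= m)%N -> a * dgamma gamma (v m) (v n) <= g n - g m.
    by move=> /um; rewrite /below /g /v /=; lra.
  have gcv : g @ \oo --> limn g.
    apply: nonincreasing_is_cvgn; last by exists 0 => _ [n _ <-]; apply: f0.
    by move=> n m /um /mono.
  have uv1 n m : (n <= m)%N -> a * mdist (v m).1 (v n).1 <= g n - g m.
    move=> /uv; apply: le_trans.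
    by rewrite ler_pM2l// le_max lexx.
  have uv2 n m : (n <= m)%N -> a * gamma * mdist (v m).2 (v n).2 <= g n - g m.
    move=> /uv; apply: le_trans.
    by rewrite -mulrA ler_pM2l// le_max lexx orbT.
  have [l1 vl1] := cX _ (cauchy_dominated a0 gcv uv1).
  have [l2 vl2] := cY _ (cauchy_dominated (mulr_gt0 a0 gamma_gt0) gcv uv2).
  have vl : v @ \oo --> (l1, l2).
    apply: cvg_trans (cvg_pair vl1 vl2).
    by apply: near_eq_cvg; apply: nearW => n; case: (v n).
  have Gl : G (l1, l2).
    by apply: (closed_cvg G clG _ _ vl); apply: nearW => n; exact: svalP (u n).
  have gl : g @ \oo --> f (l1, l2) by apply: continuous_cvg => //; exact: cf.
  exists (exist _ _ Gl) => n; rewrite /below /= -/(v n) -[f (v n)]/(g n).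
  (* For fixed [n], let [m] tend to infinity in [uv1] and [uv2]; the maximum of the two limit bounds
     is the one for [dgamma]. *)
  have H (h : nat -> R) (l c : R) : h @ \oo --> l ->
      (forall m, (n <= m)%N -> c * h m <= g n - g m) ->
      c * l <= g n - f (l1, l2).
    move=> hl hm.
    apply: (ler_cvg_to (cvgM (cvg_cst c) hl) (cvgB (cvg_cst (g n)) gl)).
    by exists n => // m /= nm; exact: hm.
  have d1 := H _ _ _ (cvg_mdist (y := (v n).1) vl1) (uv1 n).
  have d2 := H _ _ _ (cvg_mdist (y := (v n).2) vl2) (uv2 n).
  by rewrite /dgamma maxr_pMr ?(ltW a0)// mulrA addrC -lerBrDr ge_max d1 d2.
exists (sval z); split=> //; first exact: svalP.
(* Minimality gives [f w = f z], so [wz] leaves no room for a positive distance. *)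
move=> w Gw wz; apply: contrapT => /dgamma_gt0; rewrite -(pmulr_rgt0 _ a0).
by have /= := zmin (exist _ w Gw) wz; lra.
Qed.

End ProductMetric.

(** Pick a finite [r] with [b / a < r <= m], which also covers [m = +oo]; any [c] strictly between
    [b / r] and [a] then works, here the midpoint. *)
Lemma lt_slack (R : realType) (a b : R) (m : \bar R) : 0 < a -> 0 <= b ->
  (b%:E < a%:E * m)%E -> exists2 c : R, 0 < c < a & ((b / c)%:E < m)%E.
Proof.
move=> a0 b0; rewrite -lte_pdivrMl// -EFinM => bm.
have [r br rm] : exists2 r, b / a < r & (r%:E <= m)%E.
  case: m bm => [r| |]//; rewrite ?lte_fin => bm.
    by exists r; rewrite // mulrC.
  by exists (b / a + 1); rewrite ?leey// ltrDl.
have r0 : 0 < r by apply: le_lt_trans br; rewrite divr_ge0// ltW.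
have bra : b / r < a by rewrite ltr_pdivrMr// mulrC -ltr_pdivrMr.
have br0 : 0 <= b / r by rewrite divr_ge0// ltW.
exists ((b / r + a) / 2); first by apply/andP; split; lra.
apply: lt_le_trans rm; rewrite lte_fin ltr_pdivrMr; last by lra.
by rewrite mulrC -ltr_pdivrMr//; lra.
Qed.

Theorem theorem3p1 (R : realType) (P : Type) (P_nonempty : inhabited P)
    (X Y : metricType R) (F : P -> X -> set Y) (xbar : X) (ybar : Y)
    (alpha : R) (delta mu : \bar R)
    (alpha_gt0 : 0 < alpha) (delta_gt0 : (0 < delta)%E) (mu_gt0 : (0 < mu)%E) :
  (subregular_unif F xbar ybar alpha delta mu ->
    forall (p : P) (x : X) (y : Y),
      eball xbar delta x ->
      ~ inv_val (F p) ybar x ->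
      (F p x `&` eball ybar (alpha%:E * mu)%E) y ->
      (alpha%:E <=
        slope_sup (F p) xbar ybar alpha delta mu alpha^-1 (x, y))%E)
  /\
  (complete_metric X -> complete_metric Y ->
    (forall p : P, closed (gph (F p))) ->
    (exists2 gamma : R, 0 < gamma &
      forall (p : P) (x : X) (y : Y),
        eball xbar (delta + mu)%E x ->
        ~ inv_val (F p) ybar x ->
        (F p x `&` eball ybar (alpha%:E * mu)%E) y ->
        (alpha%:E <= slope_sup (F p) xbar ybar alpha delta mu gamma (x, y))%E) ->
    subregular_unif F xbar ybar alpha delta mu).
Proof.
split.
  move=> sub p x y xd nx [Fy yb].
  have dy0 : 0 < mdist y ybar.
    by rewrite mdist_gt0; apply/eqP => yE; apply: nx; rewrite -yE.
  have dle : (dist_set ybar (F p x) <= (mdist y ybar)%:E)%E.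
    by apply: ereal_inf_lbound; exists y => //; rewrite metric_sym.
  have := sub p x xd (le_lt_trans dle yb) => /le_trans/(_ dle).
  rewrite -lee_pdivlMl// => dist_le.
  have dmu : ((alpha^-1)%:E * (mdist y ybar)%:E < mu)%E by rewrite lte_pdivrMl.
  (* The bound [alpha - e] may fail to be positive; the maximum with [alpha / 2] makes division by
     [c] legitimate. *)
  apply/lee_addgt0Pr => e e0; pose c := Num.max (alpha / 2) (alpha - e).
  have c0 : 0 < c by rewrite lt_max divr_gt0.
  have calpha : c < alpha by rewrite gt_max; apply/andP; split; lra.
  suff csup : (c%:E <= slope_sup (F p) xbar ybar alpha delta mu alpha^-1 (x, y))%E.
    apply: le_trans (leeD2r _ csup); rewrite -EFinD lee_fin -lerBlDr.
    by rewrite le_max lexx orbT.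
  have bc : mdist y ybar / alpha < mdist y ybar / c.
    by rewrite ltr_pM2l// ltf_pV2.
  (* One [u] must meet both bounds: [mu] makes it admissible in the supremum, the other keeps the
     denominator small. *)
  have : (dist_set x (inv_val (F p) ybar) <
      Order.min mu (mdist y ybar / c)%:E)%E.
    by rewrite lt_min !(le_lt_trans dist_le)// -EFinM lte_fin mulrC.
  move=> /ereal_inf_lt[_ [u Fu <-]]; rewrite lt_min => /andP[umu].
  rewrite lte_fin metric_sym => uc.
  (* The choice of [gamma] as [alpha^-1] turns the second entry of the maximum into
     [d(y, ybar) / alpha], which [bc] bounds. *)
  have dc : dgamma alpha^-1 (u, ybar) (x, y) < mdist y ybar / c.
    by rewrite gt_max uc/= metric_sym mulrC.
  have uxy : (u, ybar) <> (x, y) by case=> ux _; apply: nx; rewrite -ux.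
  have d0 : 0 < dgamma alpha^-1 (u, ybar) (x, y).
    by apply: dgamma_gt0 => //; rewrite invr_gt0.
  apply: le_trans (_ : (mdist y ybar / dgamma alpha^-1 (u, ybar) (x, y))%:E <= _)%E.
    by rewrite lee_fin ler_pdivlMr// mulrC -ler_pdivlMr// ltW.
  apply: ereal_sup_ubound; exists (u, ybar); last by rewrite /= mdistxx subr0.
  split=> //=; last by rewrite mdistxx mule_gt0.
  apply: le_lt_trans (_ : (mdist x xbar + mdist x u)%:E < _)%E.
    by rewrite lee_fin (metric_sym x u) addrC metric_triangle.
  by rewrite EFinD lteD.
move=> cX cY clF [gamma gamma0 slope] p x xd xmu.
rewrite leNgt; apply/negP => lt_dist.
have : (dist_set ybar (F p x) <
    alpha%:E * Order.min mu (dist_set x (inv_val (F p) ybar)))%E.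
  by rewrite /Order.min; case: ifP.
move=> /ereal_inf_lt[_ [y Fy <-]]; rewrite metric_sym.
move=> /(lt_slack alpha_gt0 (mdist_ge0 _ _))[a /andP[a0 aalpha]].
rewrite lt_min => /andP[bmu bdist].
have cf : continuous (fun uv : X * Y => mdist uv.2 ybar).
  by move=> uv; apply: cvg_mdist; exact: cvg_snd.
have [[u v] [/= Guv uvle uvmin]] := ekeland gamma0 cX cY (clF p) cf
  (fun=> mdist_ge0 _ _) a0 (x := (x, y)) Fy.
(* Ekeland's inequality bounds [a * d(u, x)] by the drop of [d(., ybar)], at most its initial
   value. *)
have ux : mdist u x <= mdist y ybar / a.
  rewrite ler_pdivlMr// mulrC.
  apply: le_trans (_ : _ <= a * dgamma gamma (u, v) (x, y)) _.
    by rewrite ler_pM2l// le_max lexx.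
  by have := mdist_ge0 v ybar; lra.
have vy : mdist v ybar <= mdist y ybar.
  suff : 0 <= a * dgamma gamma (u, v) (x, y) by lra.
  by rewrite mulr_ge0 ?(ltW a0)// le_max mdist_ge0.
have ymu : ((mdist y ybar)%:E < alpha%:E * mu)%E.
  rewrite -lte_pdivrMl//; apply: le_lt_trans bmu.
  by rewrite -EFinM lee_fin mulrC ler_wpM2l ?mdist_ge0// lef_pV2 ?posrE// ltW.
have unF : ~ inv_val (F p) ybar u.
  move=> Fu; have : (dist_set x (inv_val (F p) ybar) <= (mdist u x)%:E)%E.
    by apply: ereal_inf_lbound; exists u => //; rewrite metric_sym.
  by apply/negP; rewrite -ltNge (le_lt_trans _ bdist)// lee_fin.
have udmu : eball xbar (delta + mu)%E u.
  apply: le_lt_trans (_ : (mdist x xbar + mdist u x)%:E < _)%E.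
    by rewrite lee_fin addrC metric_triangle.
  by rewrite EFinD lteD// (le_lt_trans _ bmu)// lee_fin.
have vmu : eball ybar (alpha%:E * mu)%E v.
  by apply: le_lt_trans ymu; rewrite lee_fin.
have := slope p u v udmu unF (conj Guv vmu).
rewrite leNgt => /negP; apply.
(* A slope above [a] would put [uv'] below [(u, v)] in Ekeland's order, forcing the two to
   coincide. *)
apply: (@le_lt_trans _ _ a%:E); last by rewrite lte_fin.
apply: ge_ereal_sup => _ [uv' [Guv' uvN _ _] <-].
have d0 := dgamma_gt0 gamma0 uvN.
rewrite lee_fin ler_pdivrMr//= leNgt; apply/negP => slope_gt.
by apply: uvN; apply: uvmin => //=; lra.
Qed.
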